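(* Let $t$ be a positive integer such that $4t+1$ is square-free. Let $X=\begin{pmatrix} R_1 & R_2\\ -R_2^\top & R_1^\top\end{pmatrix}$ be an EW matrix of order $4t+2$, where $R_1,R_2$ are $(2t+1)\times(2t+1)$ matrices, and suppose there are integers $r_1,r_2$ with $R_1J=R_1^\top J=r_1J$ and $R_2J=R_2^\top J=r_2J$ ($J$ the $(2t+1)\times(2t+1)$ all-ones matrix). Let $x_1,\ldots,x_{4t+2}$ be the invariant factors of $X$. Then: (i) $x_{4t+2}=2t(4t+1)$; (ii) $x_{4t+1}=2t$; (iii) if $t=2^\ell q$ with $\ell$ a nonnegative integer and $q$ a square-free odd integer, then \[ (x_2,\ldots,x_{4t})=([2]^{n_1},\ldots,[2^{k-1}]^{n_{k-1}},[2^k]^{n'_k},[2^kq]^{n''_k},[2^{k+1}q]^{n_{k+1}},\ldots,[2^{\ell+1}q]^{n_{\ell+1}}) \] for some integer $k$ with $1\le k\le \ell+1$ and nonnegative integers $n_1,\ldots,n_{k-1},n'_k,n''_k,n_{k+1},\ldots,n_{\ell+1}$ satisfying \[ n_1+\cdots+n_{k-1}+n'_k=2t+1,\qquad n''_k+n_{k+1}+\cdots+n_{\ell+1}=2t-2, \] \[ 1\cdot n_1+2\cdot n_2+\cdots+(\ell+1)\cdot n_{\ell+1}=3+2(\ell+2)(t-1), \] where $n_k=n'_k+n''_k$. Here $[x]^m$ denotes the list $x,\ldots,x$ with $x$ repeated $m$ times.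
   Context: For $n\equiv 2\pmod 4$, a $\{1,-1\}$-matrix $B$ of order $n$ is called an EW matrix if \[ BB^\top=B^\top B=\begin{pmatrix}(n-2)I_{n/2}+2J_{n/2} & O\\ O & (n-2)I_{n/2}+2J_{n/2}\end{pmatrix}, \] where $I$ is the identity matrix, $J$ the all-ones matrix and $O$ the zero matrix. The invariant factors of an $n\times n$ integer matrix $M$ are the diagonal entries $m_1,\dots,m_n$ of its Smith normal form: the unique diagonal matrix with nonnegative entries, $m_i\mid m_{i+1}$, equivalent to $M$ via $M\mapsto PMQ$ with $P,Q$ unimodular integer matrices. *)

(* Defs.v *)
From mathcomp Require Import all_boot all_order all_algebra.

Set Implicit Arguments.
Unset Strict Implicit.
Unset Printing Implicit Defensive.

Import GRing.Theory Num.Theory.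
Local Open Scope ring_scope.

Definition square_free (n : nat) : Prop :=
  forall d : nat, (d ^ 2 %| n)%N -> d = 1%N.

Definition all_ones (m : nat) : 'M[int]_m := const_mx 1.

(* The order is n = m + m, so that the blocks of order n / 2 = m typecheck;
   (m + m)%:Z - 2 is a subtraction in int. *)
Definition EW_gram (m : nat) : 'M[int]_(m + m) :=
  let D := ((m + m)%:Z - 2)%:M + 2 *: all_ones m in block_mx D 0 0 D.

Definition is_EW (m : nat) (B : 'M[int]_(m + m)) : Prop :=
  [/\ (m + m = 2 %[mod 4])%N,
      forall i j, B i j = 1 \/ B i j = -1,
      B *m B^T = EW_gram m
    & B^T *m B = EW_gram m].

Definition is_smith_form (n : nat) (M D : 'M[int]_n) : Prop :=
  [/\ is_diag_mx D,
      forall i, 0 <= D i i,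
      forall i j : 'I_n, j = i.+1 :> nat -> (D i i %| D j j)%Z
    & exists P Q : 'M[int]_n,
        [/\ P \in unitmx, Q \in unitmx & P *m M *m Q = D]].

(* x lists the invariant factors of M in order; the k-th one (k >= 1) is
   x`_(k - 1). *)
Definition invariant_factors (n : nat) (M : 'M[int]_n) (x : seq int) : Prop :=
  exists2 D : 'M[int]_n, is_smith_form M D & x = [seq D i i | i <- enum 'I_n].

(* Main.v *)
Require Import Defs.
From mathcomp Require Import all_boot all_order all_algebra.
From mathcomp Require Import zify ring.

(* Write h = 4t + 1. Since X X^T = 4t I + 2 diag(J, J), the integer matrix
   Z = (h X^T - X^T diag(J, J)) / 2 satisfies X Z = 2t h I, so its invariant
   factors are e_i = 2t h / x_i, and everything about the last x_i is read off
   Z modulo the smallest e_i. The rows of Z in its upper half differ by h times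
   vectors with entries in {0, 1, -1}. Hence e_(4t+2) divides h, and then r1 and
   r2; as r1^2 + r2^2 = 2h and h is square-free, e_(4t+2) = 1, which is (i).
   Modulo e_(4t+1) the matrix Z has rank one, and two such row differences have
   a 2 x 2 minor equal to +-h^2, so e_(4t+1) divides h^2. By
   det X = 2h (4t)^(2t) and (i), x_(4t+1) is prime to h, which forces
   x_(4t+1) = 2t.
   For (iii), x_1 = 1 and the other x_i are even because X has entries +-1;
   the determinant and the divisibility chain with top 2t = 2^(l+1) q then
   fix where the square-free part q enters and the sum of the 2-exponents. *)

(** * Multiplicities in sorted lists, and divisibility chains with a square-free part *)

Lemma flatten_count_mem (s : seq nat) (a b : nat) :
  sorted leq s -> all (fun i => a <= i < b) s ->
  s = flatten [seq nseq (count_mem i s) i | i <- index_iota a b].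
Proof.
(* Two sorted lists with the same multiplicities are equal, so sortedness of the right-hand side and
   a count of each value suffice. *)
move=> sorted_s /allP s_ab.
apply: (sorted_eq leq_trans anti_leq) => //.
- have fl_sorted k c :
    sorted leq (flatten [seq nseq (count_mem i s) i | i <- iota c k]).
    elim: k c => //= k IH c.
    have nseqS m r : all (leq c) r -> sorted leq r -> sorted leq (nseq m c ++ r).
      move=> c_r r_sorted; elim: m => //= m IHm.
      rewrite path_sortedE; last exact: leq_trans.
      by rewrite all_cat c_r IHm all_nseq leqnn orbT.
    apply: nseqS; last exact: IH.
    apply/allP => y /flattenP[r /mapP[i]]; rewrite mem_iota => /andP[lt_ci _] ->.
    by rewrite mem_nseq => /andP[_ /eqP->]; apply: ltnW.
  exact: fl_sorted.
- apply/allP => y _ /=; apply/eqP; rewrite count_flatten -map_comp sumnE big_map.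
  under eq_bigr => i _ do rewrite /= count_nseq /=.
  have [ys|yNs] := boolP (y \in s); last first.
    rewrite (count_memPn yNs) big1 // => i _; case: eqP => // ->.
    by rewrite (count_memPn yNs).
  rewrite (bigD1_seq y) ?iota_uniq ?mem_index_iota ?s_ab //= eqxx mul1n.
  by rewrite big1 ?addn0 // => i /negPf->; rewrite mul0n.
Qed.

(** For [b = q / gcdn q a], any common divisor of [a] and [b] divides both factors of [q], so its
    square divides [q]. *)
Lemma square_free_coprime_factor (q a : nat) :
  square_free q -> exists2 b, q = gcdn q a * b & coprime a b.
Proof.
move=> sqf; have /dvdnP[b qE] := dvdn_gcdl q a.
exists b; first by rewrite {1}qE mulnC.
apply/eqP/sqf; rewrite -mulnn {1}qE; apply: dvdn_mul.
  exact: dvdn_gcdr.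
by rewrite dvdn_gcd dvdn_gcdl {1}qE dvdn_mulr ?dvdn_gcdr.
Qed.

(** The odd number [g = gcdn q a] is prime to [q / g], so [q ^ m] contains it only [m] times,
    whereas [a ^ m.+1] needs it [m + 1] times; hence [g = 1]. *)
Lemma square_free_coprime_expn (q a m s : nat) :
  square_free q -> odd q -> a ^ m.+1 %| 2 ^ s * q ^ m -> coprime a q.
Proof.
move=> sqf odd_q dvd_a; have [b qE co_ab] := square_free_coprime_factor q a sqf.
have q_gt0 : 0 < q by case: (q) odd_q.
set g := gcdn q a in qE.
have g_gt0 : 0 < g by rewrite gcdn_gt0 q_gt0.
have co_g2 : coprime (g ^ m.+1) (2 ^ s).
  by rewrite coprimeXl // coprimeXr // coprimen2 (dvdn_odd (dvdn_gcdl q a)).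
suff g1 : g = 1 by rewrite coprime_sym /coprime -/g g1.
have : g ^ m.+1 %| 2 ^ s * q ^ m.
  by apply: dvdn_trans dvd_a; rewrite dvdn_exp2r ?dvdn_gcdr.
rewrite Gauss_dvdr // qE expnMn expnSr dvdn_pmul2l ?expn_gt0 ?g_gt0 //.
have co_gb : coprime g (b ^ m).
  by rewrite coprimeXr // (coprime_dvdl (dvdn_gcdr q a)).
by rewrite -(muln1 (b ^ m)) Gauss_dvdr // dvdn1 => /eqP.
Qed.

(** The part [b] of [q] missing from [c] is odd, prime to [c] and prime to [gcdn q c], so the
    right-hand side contains it only [m] times; hence [b = 1]. *)
Lemma square_free_dvdn_expn (q c m u N : nat) :
  square_free q -> odd q -> q ^ m.+1 %| c ^ N * (2 ^ u * q) ^ m -> q %| c.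
Proof.
move=> sqf odd_q; have [b qE co_cb] := square_free_coprime_factor q c sqf.
have q_gt0 : 0 < q by case: (q) odd_q.
have bq : b %| q by rewrite qE dvdn_mull.
have b_gt0 : 0 < b by apply: dvdn_gt0 bq.
have odd_b : odd b by apply: dvdn_odd odd_q.
move/(dvdn_trans (dvdn_exp2r m.+1 bq)) => dvd_b.
suff b1 : b = 1 by rewrite qE b1 muln1 dvdn_gcdr.
move: dvd_b.
have co_bc : coprime (b ^ m.+1) (c ^ N) by rewrite coprimeXl // coprimeXr // coprime_sym.
have co_bg : coprime b ((2 ^ u * gcdn q c) ^ m).
  rewrite coprimeXr // coprimeMr coprimeXr ?coprimen2 //=.
  by rewrite coprime_sym (coprime_dvdl (dvdn_gcdr q c)).
rewrite Gauss_dvdr // {1}qE mulnA expnMn expnS dvdn_pmul2r ?expn_gt0 ?b_gt0 //.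
by rewrite -(muln1 (_ ^ m)) Gauss_dvdr // dvdn1 => /eqP.
Qed.

Lemma dvdn_prod_nat (F G : nat -> nat) (a b : nat) :
  (forall i, a <= i < b -> F i %| G i) ->
  \prod_(a <= i < b) F i %| \prod_(a <= i < b) G i.
Proof.
move=> FG; rewrite big_nat [X in _ %| X]big_nat.
by elim/big_ind2: _ => // x1 x2 y1 y2; apply: dvdn_mul.
Qed.

(** Indices start at 0, so [d i] stands for $x_{i+1}$ and the product is $x_2\cdots x_{4t}$. A
    factor of [q] present in [d (2 * t + 1)] would occur in all $2t-1$ terms from there on, once too
    often. A factor missing from [d (2 * t + 2)] would be missing from all earlier terms too,
    leaving only $2t-3$ terms to supply $2t-2$ copies. *)
Lemma chain_dvd_split (t q s u : nat) (d : nat -> nat) :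
  0 < t -> square_free q -> odd q ->
  (forall i j, i <= j <= 4 * t -> d i %| d j) ->
  d (4 * t) = 2 ^ u * q ->
  \prod_(1 <= i < 4 * t) d i = 2 ^ s * q ^ (2 * t - 2) ->
  coprime (d (2 * t + 1)) q /\ q %| d (2 * t + 2).
Proof.
move=> t_gt0 sqf odd_q d_dvd d_top d_prod.
split.
  apply: (@square_free_coprime_expn _ _ (2 * t - 2) s) => //; rewrite -d_prod.
  rewrite (big_cat_nat (n := (2 * t + 1))); [|lia|lia].
  apply: dvdn_mull.
  have -> : (2 * t - 2).+1 = 4 * t - (2 * t + 1) by lia.
  rewrite -prod_nat_const_nat; apply: dvdn_prod_nat => i lt_i; apply: d_dvd; lia.
(* For [t = 1] the exponent [2 * t - 3] would be truncated, but then [2 * t + 2] is the top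
   index. *)
have [t1|t_gt1] : t = 1 \/ 1 < t by lia.
  have -> : 2 * t + 2 = 4 * t by lia.
  by rewrite d_top dvdn_mull.
apply: (@square_free_dvdn_expn _ _ (2 * t - 3) u (2 * t + 2)) => //.
have -> : (2 * t - 3).+1 = 2 * t - 2 by lia.
apply: (@dvdn_trans (\prod_(1 <= i < 4 * t) d i)); first by rewrite d_prod dvdn_mull.
rewrite (big_cat_nat (n := (2 * t + 3))); [|lia|lia].
apply: dvdn_mul.
  have {2}-> : 2 * t + 2 = 2 * t + 3 - 1 by lia.
  rewrite -prod_nat_const_nat; apply: dvdn_prod_nat => i lt_i; apply: d_dvd; lia.
have -> : 2 * t - 3 = 4 * t - (2 * t + 3) by lia.
rewrite -d_top -prod_nat_const_nat; apply: dvdn_prod_nat => i lt_i; apply: d_dvd; lia.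
Qed.

Lemma chain_sorted (e : nat -> nat) (a b : nat) :
  (forall i j, a <= i <= j -> j < b -> e i <= e j) ->
  sorted leq [seq e i | i <- index_iota a b].
Proof.
move=> e_mono; rewrite sorted_map.
apply: (@sub_in_sorted _ (mem (index_iota a b)) leq); last exact: iota_sorted.
- move=> i j; rewrite !mem_index_iota => /andP[ai _] /andP[_ jb] ij.
  by apply: e_mono; rewrite ?ai.
- exact/allP.
Qed.

Lemma sum_count_mem (s : seq nat) (a b : nat) :
  all (fun i => a <= i < b) s ->
  \sum_(a <= i < b) count_mem i s = size s.
Proof.
elim: s => [|y s IH] /=; first by rewrite big1.
case/andP=> y_ab /IH s_ab; rewrite big_split s_ab.
rewrite (bigD1_seq y) ?iota_uniq ?mem_index_iota //=.
by rewrite eqxx big1 // => i /negPf; rewrite eq_sym => ->.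
Qed.

Lemma sum_mul_count_mem (s : seq nat) (a b : nat) :
  all (fun i => a <= i < b) s ->
  \sum_(a <= i < b) i * count_mem i s = \sum_(i <- s) i.
Proof.
elim: s => [|y s IH] /=; first by rewrite big_nil big1 // => i; rewrite muln0.
case/andP=> y_ab /IH s_ab; rewrite big_cons -s_ab.
under eq_bigr do rewrite mulnDr.
rewrite big_split /= (bigD1_seq y) ?iota_uniq ?mem_index_iota //=.
by rewrite eqxx muln1 big1 ?addn0 // => i /negPf; rewrite eq_sym => ->; rewrite muln0.
Qed.

Lemma map_flatten_nseq (T : Type) (f : nat -> T) (n : nat -> nat) (r : seq nat) :
  [seq f j | j <- flatten [seq nseq (n i) i | i <- r]] =
  flatten [seq nseq (n i) (f i) | i <- r].
Proof.
rewrite map_flatten -map_comp; congr flatten; apply: eq_map => i /=.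
exact: map_nseq.
Qed.

(** By [chain_dvd_split] the terms up to index [2 * t + 1] are powers of 2 and the later ones are
    [q] times powers of 2. Both halves are then determined by their nondecreasing 2-exponents, which
    are listed by multiplicity. *)
Lemma chain_shape (t l q : nat) (d : nat -> nat) :
  0 < t -> square_free q -> odd q -> t = 2 ^ l * q ->
  (forall i j, i <= j <= 4 * t -> d i %| d j) ->
  2 %| d 1 -> d (4 * t) = 2 * t ->
  \prod_(1 <= i < 4 * t) d i = 8 * (4 * t) ^ (2 * t - 2) ->
  exists (k : nat) (n : nat -> nat) (n' n'' : nat),
    [/\ (1 <= k <= l + 1)%N,
        n k = n' + n'',
        [seq Posz (d i) | i <- index_iota 1 (4 * t)] =
          flatten [seq nseq (n i) (Posz (2 ^ i)) | i <- index_iota 1 k]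
          ++ nseq n' (Posz (2 ^ k))
          ++ nseq n'' (Posz (2 ^ k * q))
          ++ flatten [seq nseq (n i) (Posz (2 ^ i * q))
                     | i <- index_iota (k + 1) (l + 2)]
      & [/\ \sum_(1 <= i < k) n i + n' = 2 * t + 1,
            n'' + \sum_(k + 1 <= i < l + 2) n i = 2 * t - 2
          & \sum_(1 <= i < l + 2) i * n i = 3 + 2 * (l + 2) * (t - 1)]].
Proof.
move=> t_gt0 sqf odd_q tE d_dvd d1 d_top d_prod.
have q_gt0 : 0 < q by case: (q) odd_q.
have d_topE : d (4 * t) = 2 ^ l.+1 * q by rewrite d_top {1}tE expnS mulnA.
(* Since $4t = 2^{l+2}q$, this is the 2-exponent of $8(4t)^{2t-2}$. *)
pose s := 3 + 2 * (l + 2) * (t - 1).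
have d_prodE : \prod_(1 <= i < 4 * t) d i = 2 ^ s * q ^ (2 * t - 2).
  have -> : s = 3 + (l + 2) * (2 * t - 2) by rewrite /s; nia.
  have -> : \prod_(1 <= i < 4 * t) d i = 8 * (2 ^ (l + 2) * q) ^ (2 * t - 2).
    by rewrite d_prod {1}tE addn2 !expnS; congr (_ * _ ^ _); ring.
  by rewrite expnMn -expnM mulnA expnD.
have [d_lo d_hi] := chain_dvd_split t q s l.+1 d t_gt0 sqf odd_q d_dvd d_topE d_prodE.
pose e i := logn 2 (d i).
have loE i : i <= 2 * t + 1 -> d i = 2 ^ e i.
  move=> le_i; have : d i %| 2 ^ l.+1 * q by rewrite -d_topE d_dvd //; lia.
  rewrite Gauss_dvdl; last by apply: coprime_dvdl d_lo; apply: d_dvd; lia.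
  by case/(dvdn_pfactor _ _ (isT : prime 2)) => m _ dE; rewrite /e dE pfactorK.
have hiE i : 2 * t + 2 <= i <= 4 * t -> d i = 2 ^ e i * q.
  case/andP=> ge_i le_i; have : d i %| 2 ^ l.+1 * q by rewrite -d_topE d_dvd //; lia.
  have : q %| d i by apply: dvdn_trans d_hi _; apply: d_dvd; lia.
  case/dvdnP=> h dE; rewrite dE dvdn_pmul2r //.
  case/(dvdn_pfactor _ _ (isT : prime 2)) => m _ hE; rewrite /e dE hE.
  by rewrite lognM ?expn_gt0 // pfactorK // lognE dvdn2 odd_q /= andbF addn0.
have d_gt0 i : i <= 4 * t -> 0 < d i.
  move=> le_i; have : d i %| d (4 * t) by apply: d_dvd; lia.
  by apply: dvdn_gt0; rewrite d_top; lia.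
have e_mono i j : i <= j <= 4 * t -> e i <= e j.
  by move=> ij; apply: dvdn_leq_log; [apply: d_gt0; lia | apply: d_dvd].
have e_top : e (4 * t) = l.+1.
  by rewrite /e d_topE lognM ?expn_gt0 // pfactorK // lognE dvdn2 odd_q /= andbF addn0.
have e_ge1 i : 1 <= i <= 4 * t -> 1 <= e i.
  move=> le_i; apply: (@leq_trans (e 1)); last by apply: e_mono; lia.
  by rewrite /e -pfactor_dvdn // d_gt0 //; lia.
(* The upper half has $2t-2$ terms, each with one factor [q]; these account for all of
   [q ^ (2 * t - 2)], and the powers of 2 can be compared. *)
have e_sum : \sum_(1 <= i < 4 * t) e i = s.
  suff : 2 ^ (\sum_(1 <= i < 4 * t) e i) * q ^ (2 * t - 2) = 2 ^ s * q ^ (2 * t - 2).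
    move/eqP; rewrite eqn_pmul2r ?expn_gt0 ?q_gt0 // eqn_exp2l //.
    by move/eqP.
  rewrite -d_prodE (big_morph (expn 2) (expnD 2) (expn0 2)).
  rewrite [in RHS](big_cat_nat (n := 2 * t + 2)); [|lia|lia].
  rewrite [in LHS](big_cat_nat (n := 2 * t + 2)); [|lia|lia].
  rewrite -mulnA; congr (_ * _).
    by apply: eq_big_nat => i le_i; rewrite [RHS]loE //; lia.
  have -> : 2 * t - 2 = 4 * t - (2 * t + 2) by lia.
  rewrite -prod_nat_const_nat -big_split /=.
  by apply: eq_big_nat => i le_i; rewrite [RHS]hiE //; lia.
(* The last exponent before [q] enters: exponents are at most [k] in the first half and at least [k]
   in the second, so [k] is the only value that both halves can share. *)
pose k := e (2 * t + 1).
pose s1 := [seq e i | i <- index_iota 1 (2 * t + 2)].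
pose s2 := [seq e i | i <- index_iota (2 * t + 2) (4 * t)].
have s1_sorted : sorted leq s1 by apply: chain_sorted => i j ij lt_j; apply: e_mono; lia.
have s2_sorted : sorted leq s2 by apply: chain_sorted => i j ij lt_j; apply: e_mono; lia.
have s1_k : all (fun i => 1 <= i < k.+1) s1.
  apply/allP => y /mapP[i]; rewrite mem_index_iota => i_s1 ->.
  by rewrite e_ge1 ?ltnS ?e_mono //; lia.
have s2_k : all (fun i => k <= i < l.+2) s2.
  apply/allP => y /mapP[i]; rewrite mem_index_iota => i_s2 ->.
  by rewrite ltnS -e_top !e_mono //; lia.
have k_l : k <= l.+1 by rewrite -e_top e_mono //; lia.
have k_ge1 : 1 <= k by rewrite e_ge1 //; lia.
pose n i := count_mem i (s1 ++ s2).
have n_lo i : i < k -> n i = count_mem i s1.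
  move=> lt_ik; rewrite /n count_cat [X in _ + X](count_memPn _) ?addn0 //.
  by apply/negP => /(allP s2_k); lia.
have n_hi i : k < i -> n i = count_mem i s2.
  move=> lt_ki; rewrite /n count_cat [X in X + _](count_memPn _) //.
  by apply/negP => /(allP s1_k); lia.
exists k, n, (count_mem k s1), (count_mem k s2); split.
- lia.
- by rewrite /n count_cat.
- have -> : index_iota 1 (4 * t) =
      index_iota 1 (2 * t + 2) ++ index_iota (2 * t + 2) (4 * t).
    have eq_len : 4 * t - 1 = (2 * t + 2 - 1) + (4 * t - (2 * t + 2)) by lia.
    by rewrite /index_iota eq_len iotaD; congr (_ ++ iota _ _); lia.
  rewrite map_cat catA; congr (_ ++ _).
    rewrite (_ : map _ _ = [seq Posz (2 ^ i) | i <- s1]); last first.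
      rewrite -map_comp; apply/eq_in_map => i; rewrite mem_index_iota => i_s1 /=.
      by rewrite loE //; lia.
    rewrite {1}(flatten_count_mem s1 1 k.+1) // map_flatten_nseq.
    have -> : index_iota 1 k.+1 = index_iota 1 k ++ [:: k].
      by rewrite /index_iota subSn // -[(k - 1).+1]addn1 iotaD subnKC.
    rewrite map_cat flatten_cat /= cats0; congr (flatten _ ++ _).
    by apply/eq_in_map => i; rewrite mem_index_iota => i_k; rewrite n_lo //; lia.
  rewrite (_ : map _ _ = [seq Posz (2 ^ i * q) | i <- s2]); last first.
    rewrite -map_comp; apply/eq_in_map => i; rewrite mem_index_iota => i_s2 /=.
    by rewrite hiE //; lia.
  rewrite {1}(flatten_count_mem s2 k l.+2) //.
  rewrite (map_flatten_nseq _ (fun i => Posz (2 ^ i * q))).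
  have -> : index_iota k l.+2 = k :: index_iota (k + 1) (l + 2).
    by rewrite /index_iota subSn //= addn1 addn2 subSS.
  congr (_ ++ flatten _).
  by apply/eq_in_map => i; rewrite mem_index_iota => i_k; rewrite n_hi //; lia.
split.
- have <- : size s1 = 2 * t + 1 by rewrite size_map size_iota; lia.
  rewrite -(sum_count_mem s1 1 k.+1) // big_nat_recr //=; congr (_ + _).
  by apply: eq_big_nat => i i_k; rewrite n_lo //; lia.
- have <- : size s2 = 2 * t - 2 by rewrite size_map size_iota; lia.
  rewrite -(sum_count_mem s2 k l.+2) // [RHS]big_ltn //; congr (_ + _).
  by rewrite addn1 addn2; apply: eq_big_nat => i i_k; rewrite n_hi //; lia.
rewrite -[RHS]/s -e_sum addn2 sum_mul_count_mem.
  rewrite big_cat !big_map.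
  by rewrite [in RHS](big_cat_nat (n := 2 * t + 2)); [|lia|lia].
rewrite all_cat; apply/andP; split.
  by apply: sub_all s1_k => i; lia.
by apply: sub_all s2_k => i; lia.
Qed.

Import GRing.Theory Num.Theory.
Local Open Scope ring_scope.

(** * Smith normal forms of integer matrices *)

Lemma smith_form_dvd (n : nat) (M D : 'M[int]_n) (i j : 'I_n) :
  is_smith_form M D -> (i <= j)%N -> (D i i %| D j j)%Z.
Proof.
case=> _ _ dvdS _; case: j => j; elim: j => [|j IH] ltj /= le_ij.
  suff -> : i = Ordinal ltj by [].
  by apply/val_inj => /=; lia.
have [->|neq_ij] := eqVneq i (Ordinal ltj); first by [].
have le_ij' : (i <= j)%N by move: neq_ij; rewrite -val_eqE /=; lia.
by apply: (dvdz_trans (IH (ltnW ltj) le_ij')); apply: dvdS.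
Qed.

(** Unimodular factors have determinant 1 or -1, so squares of determinants agree, and nonnegativity
    of the diagonal selects the root. For an EW matrix only the square is available, from the Gram
    matrix. *)
Lemma smith_form_det (n : nat) (M D : 'M[int]_n) (c : int) :
  is_smith_form M D -> 0 <= c -> \det M ^+ 2 = c ^+ 2 ->
  \prod_i D i i = c.
Proof.
case=> /is_diag_mxP diagD D_ge0 _ [P [Q [uP uQ defD]]] c_ge0 detM.
have detD : \det D = \prod_i D i i.
  apply: det_trig; apply/is_trig_mxP => i j lt_ij; apply: diagD.
  by rewrite neq_ltn lt_ij.
have sq1 (U : 'M[int]_n) : U \in unitmx -> \det U ^+ 2 = 1.
  by rewrite unitmxE qualifE /= => /orP[]/eqP->.
have eq_sq : (\prod_i D i i) ^+ 2 = c ^+ 2.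
  by rewrite -detD -defD !det_mulmx !exprMn (sq1 P) // (sq1 Q) // detM mul1r mulr1.
apply/eqP; rewrite -(@eqrXn2 _ 2) ?eq_sq //.
by apply: prodr_ge0 => i _; apply: D_ge0.
Qed.

(** If [P *m M *m Q = D], then $E = Q^{-1}ZP^{-1}$ satisfies $DE = cI$, so it is diagonal with
    entries $c/d_k$, and $Z = QEP$. Complementary divisors reverse the divisibility chain. *)
Lemma smith_form_dual (n : nat) (M D Z : 'M[int]_n) (c : int) :
  is_smith_form M D -> c != 0 -> M *m Z = c%:M ->
  exists (A B : 'M[int]_n) (e : 'I_n -> int),
    [/\ forall k, D k k * e k = c,
        forall i j : 'I_n, (i <= j)%N -> (e j %| e i)%Z
      & forall i j, Z i j = \sum_k A i k * e k * B k j].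
Proof.
move=> smD c_neq0 MZ; have := smith_form_dvd _ _ _ _ _ smD => dvdD.
case: smD => diagD _ _ [P [Q [uP uQ defD]]].
pose E := invmx Q *m Z *m invmx P.
have DE : D *m E = c%:M.
  rewrite -defD /E !mulmxA mulmxK // -(mulmxA P M Z) MZ.
  by rewrite scalar_mxC mulmxK.
have ZE : Z = Q *m E *m P by rewrite /E !mulmxA mulmxV // mul1mx mulmxKV.
clearbody E.
have DEij i j : D i i * E i j = c *+ (i == j).
  move/matrixP: DE => /(_ i j); rewrite !mxE (bigD1 i) //= big1 ?addr0 // => k.
  by move=> neq_ki; move/is_diag_mxP: diagD => -> //; rewrite ?mul0r // eq_sym.
have D_neq0 i : D i i != 0.
  apply/eqP => Di0; move: (DEij i i); rewrite Di0 mul0r eqxx => /esym/eqP.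
  by apply/negP.
exists Q, P, (fun k => E k k); split.
- by move=> k; rewrite DEij eqxx.
- move=> i j /(dvdD _ _)/dvdzP[k Dj]; apply/dvdzP; exists k.
  apply: (mulfI (D_neq0 i)); rewrite DEij eqxx mulrA (mulrC _ k) -Dj.
  by rewrite DEij eqxx.
- move=> i j; rewrite ZE mxE; apply: eq_bigr => k _.
  rewrite mxE (bigD1 k) //= big1 ?addr0 //.
  move=> h neq_hk; suff -> : E h k = 0 by rewrite mulr0.
  apply: (mulfI (D_neq0 h)); by rewrite DEij (negPf neq_hk) mulr0.
Qed.

(** The bordered matrix [M] is made triangular in two ways by column operations. The second uses a
    multiplier of determinant [a], which avoids division and explains the extra factor on the
    left. *)
Lemma det_scalar_add_ones (a b : int) (m : nat) :
  a * \det (a%:M + b *: all_ones m) = (a + b * m%:R) * a ^+ m.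
Proof.
pose u : 'cV[int]_m := const_mx 1; pose v : 'rV[int]_m := const_mx 1.
pose M := block_mx (1%:M : 'M_1) (- (b *: v)) u (a%:M : 'M_m).
have uv : u *m v = all_ones m.
  by apply/matrixP => i j; rewrite !mxE big_ord1 !mxE mulr1.
have vu : v *m u = (m%:R)%:M.
  apply/matrixP => i j; rewrite !mxE !ord1 eqxx mulr1n.
  under eq_bigr do rewrite !mxE mulr1.
  by rewrite sumr_const card_ord.
have detM : \det M = \det (a%:M + b *: all_ones m).
  have : M *m block_mx 1%:M (b *: v) 0 1%:M
       = block_mx 1%:M 0 u (a%:M + b *: all_ones m).
    rewrite mulmx_block !mulmx1 !mul1mx !mulmx0 !addr0 subrr.
    by rewrite -scalemxAr uv addrC.
  move/(congr1 determinant).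
  by rewrite det_mulmx det_ublock det_lblock !det1 !mulr1 mul1r.
have : M *m block_mx a%:M 0 (- u) 1%:M
     = block_mx ((a + b * m%:R)%:M) (- (b *: v)) 0 a%:M.
  rewrite mulmx_block !mulmx1 !mul1mx !mulmx0 !add0r mulNmx mulmxN opprK.
  rewrite -scalemxAl vu scale_scalar_mx mulmxN scalar_mxC.
  by rewrite subrr -raddfD.
move/(congr1 determinant); rewrite det_mulmx det_ublock det_lblock !det1 detM.
by rewrite !det_scalar1 mulr1 det_scalar mulrC.
Qed.

(** The first invariant factor divides every entry of [M], hence is 1. Modulo 2 the matrix [M] is
    all ones, so [D] is congruent to the rank-one matrix $(a_k b_j)$; from $a_o b_o \equiv 1$ and
    $a_o b_i \equiv 0$ follows $b_i \equiv 0$. *)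
Lemma smith_form_pm1 (n : nat) (M D : 'M[int]_n) (o i : 'I_n) :
  is_smith_form M D -> (forall i j, M i j = 1 \/ M i j = -1) -> o = 0%N :> nat ->
  D o o = 1 /\ (i != o -> (2 %| D i i)%Z).
Proof.
move=> smD pm1 o0; have := smith_form_dvd _ _ _ _ _ smD => dvdD.
case: smD => /is_diag_mxP diagD D_ge0 _ [P [Q [uP uQ defD]]].
have Doo : D o o = 1.
  have dvdDo k j : (D o o %| D k j)%Z.
    by have [<-|/diagD->] := eqVneq k j; rewrite ?dvdz0 // dvdD // o0.
  have : (D o o %| M o o)%Z.
    have -> : M = invmx P *m D *m invmx Q.
      by rewrite -defD !mulmxA mulVmx // mul1mx mulmxK.
    rewrite mxE rpred_sum // => k _; rewrite mxE dvdz_mulr // rpred_sum // => j _.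
    by rewrite dvdz_mull.
  by move: (D_ge0 o); case: (pm1 o o) => ->; rewrite ?rpredN dvdz1 => ? /eqP; lia.
split=> // i_neq_o.
pose N := \matrix_(i, j) (if M i j == 1 then 0 else - 1 : int).
have MN : M = const_mx 1 + 2 *: N.
  by apply/matrixP => k j; rewrite !mxE; case: (pm1 k j) => ->.
pose a k := \sum_j P k j; pose b j := \sum_k Q k j; pose c := P *m N *m Q.
have DE k j : D k j = a k * b j + 2 * c k j.
  rewrite -defD MN mulmxDr mulmxDl -scalemxAr -scalemxAl mxE [in X in _ + X]mxE.
  congr (_ + _); rewrite mxE /b mulr_sumr; apply: eq_bigr => h _; congr (_ * _).
  by rewrite mxE; apply: eq_bigr => p _; rewrite mxE mulr1.
have Dio : D o i = 0 by apply: diagD; rewrite eq_sym.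
(* Since [D o o = 1] and [D o i = 0], $b_i = b_i D_{oo} - b_o D_{oi} = 2(b_i c_{oo} - b_o c_{oi})$;
   substituting this in $D_{ii} = a_i b_i + 2c_{ii}$ gives the witness. *)
apply/dvdzP; exists (a i * (c o o * b i - c o i * b o) + c i i).
move: Doo Dio; rewrite !DE => Doo Dio.
have : b i = b i * (a o * b o + 2 * c o o) - b o * (a o * b i + 2 * c o i).
  by rewrite Doo Dio; ring.
by move=> {1}->; ring.
Qed.

(** * Determinant, row sums and scaled inverse of an EW matrix *)

Lemma det_EW_gram (t : nat) : (0 < t)%N ->
  \det (EW_gram (2 * t).+1) = ((2 * (4 * t + 1) * (4 * t) ^ (2 * t))%N%:Z) ^+ 2.
Proof.
move=> t_gt0; rewrite /EW_gram det_ublock -expr2; congr (_ ^+ 2).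
have -> : ((2 * t).+1 + (2 * t).+1)%:Z - 2 = (4 * t)%N%:Z by lia.
have a_neq0 : (4 * t)%N%:Z != 0 by lia.
apply: (mulfI a_neq0); rewrite det_scalar_add_ones exprS.
have PoszX a k : (a ^ k)%N%:Z = a%:Z ^+ k by rewrite -!natz natrX.
rewrite !PoszM PoszX PoszD !PoszM.
have -> : ((2 * t).+1)%:R = 2 * t%:Z + 1 :> int by rewrite natz; lia.
by ring.
Qed.

Lemma scalemx_ones_inj (m : nat) (a b : int) :
  a *: all_ones m.+1 = b *: all_ones m.+1 -> a = b.
Proof. by move/matrixP => /(_ ord0 ord0); rewrite !mxE !mulr1. Qed.

Lemma all_ones_sqr (m : nat) : all_ones m *m all_ones m = m%:Z *: all_ones m.
Proof.
apply/matrixP => i j; rewrite !mxE.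
under eq_bigr do rewrite !mxE mulr1.
by rewrite sumr_const card_ord mulr1 natz.
Qed.

Section EW.
Variables (t : nat) (R1 R2 : 'M[int]_((2 * t).+1)) (r1 r2 : int).
Let J := all_ones (2 * t).+1.
Let X := block_mx R1 R2 (- R2^T) R1^T.
Hypothesis EW_X : is_EW X.
Hypotheses (R1J : R1 *m J = r1 *: J) (R1TJ : R1^T *m J = r1 *: J)
   (R2J : R2 *m J = r2 *: J) (R2TJ : R2^T *m J = r2 *: J).

(** Multiply the upper left block of $XX^\top$ by $J$; the right-hand side becomes $4t + 2(2t+1)$
    times $J$. *)
Lemma EW_row_sums : r1 ^+ 2 + r2 ^+ 2 = 2 * (4 * t%:Z + 1).
Proof.
case: EW_X => _ _ XXT _.
have : R1 *m R1^T + R2 *m R2^T = (4 * t%:Z)%:M + 2 *: J.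
  have <- : ((2 * t).+1 + (2 * t).+1)%:Z - 2 = 4 * t%:Z by lia.
  by move: XXT; rewrite /X tr_block_mx mulmx_block => /eq_block_mx[].
move/(congr1 (fun A => A *m J)).
rewrite !mulmxDl -!mulmxA R1TJ R2TJ -!scalemxAr R1J R2J.
rewrite -scalemxAl all_ones_sqr mul_scalar_mx !scalerA -!scalerDl.
by move/scalemx_ones_inj; rewrite -!expr2 => ->; lia.
Qed.

(** This is $2Z$ for the matrix $Z$ of the overview: under the row-sum hypotheses the subtracted
    block matrix is $X^\top\mathrm{diag}(J,J)$. Halving is postponed until all entries are known to
    be even. *)
Definition EW_adj : 'M[int]_((2 * t).+1 + (2 * t).+1) :=
  (4 * t%:Z + 1) *: X^T - block_mx (r1 *: J) (- r2 *: J) (r2 *: J) (r1 *: J).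

(** By [EW_row_sums], [X] times the subtracted block matrix is $2h\,\mathrm{diag}(J,J)$ with $h =
    4t+1$, exactly the $J$-part of $hXX^\top$. *)
Lemma mul_EW_adj : X *m EW_adj = (2 * (2 * t%:Z * (4 * t%:Z + 1)))%:M.
Proof.
case: EW_X => _ _ XXT _.
have gram : X *m block_mx (r1 *: J) (- r2 *: J) (r2 *: J) (r1 *: J)
   = (2 * (4 * t%:Z + 1)) *: block_mx J 0 0 J.
  rewrite /X mulmx_block !mulNmx -!scalemxAr R1J R1TJ R2J R2TJ !scalerA.
  rewrite -!scaleNr -!scalerDl scale_block_mx !scaler0 -EW_row_sums.
  congr block_mx.
  - by rewrite (_ : - r2 * r1 + r1 * r2 = 0) ?scale0r; last ring.
  - by rewrite (_ : - (r1 * r2) + r2 * r1 = 0) ?scale0r; last ring.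
  - by congr (_ *: _); ring.
rewrite /EW_adj mulmxBr -scalemxAr XXT gram /EW_gram -/J !scale_block_mx.
rewrite opp_block_mx add_block_mx !scaler0 !subr0 [RHS]scalar_mx_block.
have -> : ((2 * t).+1 + (2 * t).+1)%:Z - 2 = 4 * t%:Z by lia.
suff -> : (4 * t%:Z + 1) *: ((4 * t%:Z)%:M + 2 *: J) - (2 * (4 * t%:Z + 1)) *: J
   = (2 * (2 * t%:Z * (4 * t%:Z + 1)))%:M by [].
apply/matrixP => i j; rewrite !mxE !mulr1.
by case: (i == j); rewrite ?mulr1n ?mulr0n; ring.
Qed.

Lemma EW_adj_entry (i j : 'I_(2 * t).+1) :
  (EW_adj (lshift _ i) (lshift _ j) = (4 * t%:Z + 1) * X (lshift _ j) (lshift _ i) - r1) *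
  (EW_adj (lshift _ i) (rshift _ j) = (4 * t%:Z + 1) * X (rshift _ j) (lshift _ i) + r2).
Proof.
split; rewrite /EW_adj mxE [X in X + _]mxE [X in _ + X]mxE [X^T _ _]mxE.
  by congr (_ - _); rewrite block_mxEul !mxE mulr1.
by congr (_ + _); rewrite block_mxEur !mxE mulr1 opprK.
Qed.

Lemma EW_pm1 i j : X i j = 1 \/ X i j = -1.
Proof. by case: EW_X. Qed.

(** The sum of squares $2(4t+1)$ is 2 modulo 4; mixed parities would make it odd, and two even
    numbers would make it divisible by 4. *)
Lemma EW_row_sums_odd : (exists a, r1 = 2 * a + 1) /\ (exists b, r2 = 2 * b + 1).
Proof.
have sumE := EW_row_sums; rewrite !expr2 in sumE.
have par (r : int) : (exists a, r = 2 * a) \/ (exists a, r = 2 * a + 1).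
  have := modz_ge0 r (isT : 2 != 0 :> int); have := ltz_pmod r (isT : 0 < 2 :> int).
  have := divz_eq r 2; set u := (r %/ 2)%Z; set v := (r %% 2)%Z => rE v2 v0.
  have [v_0|v_1] : v = 0 \/ v = 1 by lia.
    by left; exists u; lia.
  by right; exists u; lia.
case: (par r1) (par r2) => [][a r1E] [][b r2E]; first 1 last.
- by exfalso; nia.
- by exfalso; nia.
- by split; [exists a | exists b].
exfalso; move: sumE; rewrite r1E r2E => sumE.
have : a * a + b * b + (a * a + b * b) = 4 * t%:Z + 1 by nia.
lia.
Qed.

(** Each entry is a difference of two odd numbers: $\pm(4t+1)$ and one of $r_1$, $r_2$, $-r_2$. *)
Lemma EW_adj_even : exists Z : 'M[int]_((2 * t).+1 + (2 * t).+1), EW_adj = 2 *: Z.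
Proof.
have [[a r1E] [b r2E]] := EW_row_sums_odd.
exists (\matrix_(i, j) (EW_adj i j %/ 2)%Z).
have dvd_odd (y u : int) : y = 1 \/ y = -1 -> (2 %| (4 * t%:Z + 1) * y - (2 * u + 1))%Z.
  case=> ->; apply/dvdzP; [exists (2 * t%:Z - u) | exists (- (2 * t%:Z) - u - 1)]; ring.
apply/matrixP => i j; rewrite [RHS]mxE [X in _ * X]mxE mulrC divzK //.
rewrite /EW_adj mxE [X in X + _]mxE [X in _ + X]mxE [X^T _ _]mxE.
suff [u ->] : exists u, block_mx (r1 *: J) (- r2 *: J) (r2 *: J) (r1 *: J) i j = 2 * u + 1.
  exact: dvd_odd (EW_pm1 _ _).
case: (split_ordP i) => i' ->; case: (split_ordP j) => j' ->.
- by exists a; rewrite block_mxEul !mxE mulr1.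
- by exists (- b - 1); rewrite block_mxEur !mxE mulr1 r2E; ring.
- by exists b; rewrite block_mxEdl !mxE mulr1.
- by exists a; rewrite block_mxEdr !mxE mulr1.
Qed.

Lemma EW_col_dot (i j : 'I_(2 * t).+1) : i != j ->
  \sum_k X k (lshift _ i) * X k (lshift _ j) = 2.
Proof.
move=> i_neq_j; case: EW_X => _ _ _ /matrixP/(_ (lshift _ i) (lshift _ j)).
rewrite /EW_gram block_mxEul mxE => dotE.
transitivity (\sum_k X^T (lshift _ i) k * X k (lshift _ j)).
  by apply: eq_bigr => k _; rewrite [X^T _ _]mxE.
by rewrite dotE !mxE (negPf i_neq_j) mulr0n mulr1 add0r.
Qed.

Hypothesis t_gt0 : (0 < t)%N.

(* [\sum_k (x k - y k) * (x k + z k) = (4 * t + 2) + 2 - 2 - 2] is nonzero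
   for the columns [x], [y], [z] numbered [i1], [i2], [i3]. *)
Lemma EW_col_separate (i1 i2 i3 : 'I_(2 * t).+1) :
  i1 != i2 -> i1 != i3 -> i2 != i3 ->
  exists k, X k (lshift _ i1) != X k (lshift _ i2) /\
            X k (lshift _ i1) = X k (lshift _ i3).
Proof.
move=> n12 n13 n23.
pose x i k := X k (lshift (2 * t).+1 i).
have sumE : \sum_k (x i1 k - x i2 k) * (x i1 k + x i3 k) = (4 * t)%N%:Z.
  under eq_bigr do rewrite mulrBl !mulrDr.
  have n21 : i2 != i1 by rewrite eq_sym.
  rewrite sumrB !big_split /=.
  rewrite (EW_col_dot _ _ n13) (EW_col_dot _ _ n23) (EW_col_dot _ _ n21).
  rewrite (eq_bigr (fun=> 1)); last first.
    by move=> k _; rewrite /x; case: (EW_pm1 k (lshift _ i1)) => ->.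
  by rewrite sumr_const card_ord natz; lia.
have [k /andP[k12 k13]|none] := pickP (fun k => (x i1 k != x i2 k) && (x i1 k == x i3 k)).
  by exists k; split=> //; apply/eqP.
have : (4 * t)%N%:Z = 0.
  rewrite -sumE big1 // => k _; move: (none k); rewrite /x.
  by case: (EW_pm1 k (lshift _ i1)) => ->; case: (EW_pm1 k (lshift _ i2)) => ->;
     case: (EW_pm1 k (lshift _ i3)) => ->.
by move/eqP; lia.
Qed.

Lemma EW_det (D : 'M[int]_((2 * t).+1 + (2 * t).+1)) : is_smith_form X D ->
  \prod_i D i i = (2 * (4 * t + 1) * (4 * t) ^ (2 * t))%N%:Z.
Proof.
move=> smD; apply: (smith_form_det _ _ _ _ smD) => //.
by case: EW_X => _ _ XXT _; rewrite -det_EW_gram // -XXT det_mulmx det_tr expr2.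
Qed.
End EW.

(* Modulo [e p] only the [q]-th term of each sum survives: [Z] has rank one. *)
Lemma smith_dual_minor (n : nat) (A B Z : 'M[int]_n) (e : 'I_n -> int) (p q : 'I_n) :
  (forall i j, Z i j = \sum_k A i k * e k * B k j) ->
  (forall k, k != q -> (e p %| e k)%Z) ->
  forall i1 i2 i3 j1 j2 : 'I_n,
    (e p %| (Z i1 j1 - Z i2 j1) * (Z i1 j2 - Z i3 j2)
            - (Z i1 j2 - Z i2 j2) * (Z i1 j1 - Z i3 j1))%Z.
Proof.
move=> ZE e_dvd i1 i2 i3 j1 j2.
have rank1 i j : exists c, Z i j = A i q * e q * B q j + c * e p.
  suff /dvdzP[c cE] : (e p %| \sum_(k | k != q) A i k * e k * B k j)%Z.
    by exists c; rewrite ZE (bigD1 q) //= cE.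
  by apply: rpred_sum => k /e_dvd e_pk; rewrite dvdz_mulr // dvdz_mull.
have [c1 ->] := rank1 i1 j1; have [c2 ->] := rank1 i2 j1; have [c3 ->] := rank1 i3 j1.
have [d1 ->] := rank1 i1 j2; have [d2 ->] := rank1 i2 j2; have [d3 ->] := rank1 i3 j2.
set a1 := A i1 q * e q; set a2 := A i2 q * e q; set a3 := A i3 q * e q.
apply/dvdzP; exists ((a1 - a2) * B q j1 * (d1 - d3)
  + (c1 - c2) * ((a1 - a3) * B q j2 + (d1 - d3) * e p)
  - (a1 - a2) * B q j2 * (c1 - c3)
  - (d1 - d2) * ((a1 - a3) * B q j1 + (c1 - c3) * e p)).
ring.
Qed.

(** * The two largest invariant factors *)

Lemma cofactor_eq_double (t d e : nat) :
  (0 < t)%N -> (d * e = 2 * t * (4 * t + 1))%N -> (e %| (4 * t + 1) ^ 2)%N ->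
  (d * (2 * t * (4 * t + 1)) %| 2 * (4 * t + 1) * (4 * t) ^ (2 * t))%N ->
  d = (2 * t)%N.
Proof.
move=> t_gt0 de e_dvd d_dvd.
(* Cancelling $2(4t+1)$ in the last hypothesis leaves $dt \mid (4t)^{2t}$, which is prime to
   $4t+1$. *)
have co : coprime d (4 * t + 1).
  move: d_dvd; rewrite (_ : (d * _ = d * t * (2 * (4 * t + 1)))%N); last by ring.
  rewrite (mulnC (2 * (4 * t + 1))%N) dvdn_pmul2r; last by rewrite addn1.
  move/(dvdn_trans (dvdn_mulr t (dvdnn d)))/coprime_dvdl; apply.
  by rewrite coprimeXl // /coprime gcdnDl gcdn1.
apply/eqP; rewrite eqn_dvd; apply/andP; split.
  by rewrite -(Gauss_dvdl _ co) -de dvdn_mulr.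
(* Conversely, one factor $4t+1$ cancels here, and the other is prime to $2t$. *)
have : (2 * t * (4 * t + 1) %| d * (4 * t + 1) ^ 2)%N.
  by rewrite -de dvdn_mul.
rewrite -mulnn mulnA dvdn_pmul2r ?addn1 // Gauss_dvdl //.
by rewrite (_ : (4 * t).+1 = (2 * (2 * t) + 1)%N) ?/coprime ?gcdnMDl ?gcdn1 //; lia.
Qed.

Lemma EW_last_factors (t : nat) (R1 R2 : 'M[int]_((2 * t).+1)) (r1 r2 : int)
    (D : 'M[int]_((2 * t).+1 + (2 * t).+1)) (p q : 'I_((2 * t).+1 + (2 * t).+1)) :
  (0 < t)%N -> square_free (4 * t + 1)%N ->
  let J := all_ones (2 * t).+1 in
  let X := block_mx R1 R2 (- R2^T) R1^T in
  is_EW X ->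
  R1 *m J = r1 *: J -> R1^T *m J = r1 *: J ->
  R2 *m J = r2 *: J -> R2^T *m J = r2 *: J ->
  is_smith_form X D -> p = (4 * t)%N :> nat -> q = (4 * t + 1)%N :> nat ->
  D q q = (2 * t * (4 * t + 1))%N%:Z /\ D p p = (2 * t)%N%:Z.
Proof.
move=> t_gt0 sqf J X EW_X R1J R1TJ R2J R2TJ smD p_val q_val.
pose h : int := 4 * t%:Z + 1.
have [Z ZE] := EW_adj_even _ _ _ _ _ EW_X R1J R1TJ R2J R2TJ.
have XZ : X *m Z = (2 * t%:Z * h)%:M.
  have := mul_EW_adj _ _ _ _ _ EW_X R1J R1TJ R2J R2TJ.
  rewrite ZE -scalemxAr -scale_scalar_mx => XZ2.
  by apply/matrixP => i j; move/matrixP/(_ i j): XZ2; rewrite !mxE => /mulfI; apply.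
have c_gt0 : 0 < 2 * t%:Z * h by rewrite /h; lia.
have c_neq0 : 2 * t%:Z * h != 0 by rewrite lt0r_neq0.
have [A [B [e [De e_dvd Z_sum]]]] := smith_form_dual _ _ _ _ _ smD c_neq0 XZ.
have D_ge0 i : 0 <= D i i by case: smD.
(* Three distinct indices exist because $2t+1 \ge 3$. *)
pose i0 : 'I_(2 * t).+1 := inord 0; pose i1 : 'I_(2 * t).+1 := inord 1.
pose i2 : 'I_(2 * t).+1 := inord 2.
have n01 : i0 != i1 by rewrite -val_eqE /= !inordK //; lia.
have n02 : i0 != i2 by rewrite -val_eqE /= !inordK //; lia.
have n12 : i1 != i2 by rewrite -val_eqE /= !inordK //; lia.
(* The terms in [r1] and [r2] are constant along each column of the upper half of [Z], so they
   cancel in row differences. *)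
have Zdiff i i' k :
    2 * (Z (lshift _ i) k - Z (lshift _ i') k) = h * (X k (lshift _ i) - X k (lshift _ i')).
  have entry := EW_adj_entry t R1 R2 r1 r2.
  have adjE a b : EW_adj t R1 R2 r1 r2 a b = 2 * Z a b by rewrite ZE mxE.
  rewrite mulrBr -!adjE; case: (split_ordP k) => k' ->; rewrite !entry -/X -/h; ring.
have Zdiff1 i i' k : X k (lshift _ i) != X k (lshift _ i') ->
    (Z (lshift _ i) k - Z (lshift _ i') k = h \/ Z (lshift _ i) k - Z (lshift _ i') k = - h).
  have := Zdiff i i' k; case: EW_X => _ pm1 _ _.
  by case: (pm1 k (lshift _ i)) => ->; case: (pm1 k (lshift _ i')) => -> //; lia.
have Zdiff0 i i' k : X k (lshift _ i) = X k (lshift _ i') ->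
    Z (lshift _ i) k - Z (lshift _ i') k = 0.
  by move=> Xeq; have := Zdiff i i' k; rewrite Xeq subrr mulr0; lia.
have sep := EW_col_separate _ _ _ EW_X t_gt0.
(* In column [j1] row 0 of [Z] differs from row 1 but agrees with row 2; in [j2] it is the reverse.
   The $2\times 2$ minor of these differences is therefore diagonal, with entries $\pm h$. *)
have [j1 [X01 X02]] := sep i0 i1 i2 n01 n02 n12.
have [j2 [X02' X01']] : exists k, X k (lshift _ i0) != X k (lshift _ i2) /\
    X k (lshift _ i0) = X k (lshift _ i1) by apply: sep; rewrite // eq_sym.
have le_q (k : 'I_((2 * t).+1 + (2 * t).+1)) : (k <= q)%N.
  by rewrite q_val; have := ltn_ord k; lia.
have eqZ i j : (e q %| Z i j)%Z.
  by rewrite Z_sum; apply: rpred_sum => k _; rewrite dvdz_mulr // dvdz_mull // e_dvd.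
have eq_h : (e q %| h)%Z.
  have : (e q %| Z (lshift _ i0) j1 - Z (lshift _ i1) j1)%Z by apply: rpredB.
  by case: (Zdiff1 _ _ _ X01) => ->; rewrite ?rpredN.
have sumE := EW_row_sums _ _ _ _ _ EW_X R1J R1TJ R2J R2TJ.
have eq_r : (e q %| r1)%Z /\ (e q %| r2)%Z.
  have [entry1 entry2] := EW_adj_entry t R1 R2 r1 r2 ord0 ord0.
  rewrite ZE mxE -/X -/h in entry1; rewrite ZE mxE -/X -/h in entry2.
  split.
    rewrite (_ : r1 = h * X (lshift _ ord0) (lshift _ ord0)
                      - 2 * Z (lshift _ ord0) (lshift _ ord0)).
      by rewrite rpredB //; [exact: dvdz_mulr | exact: dvdz_mull].
    by rewrite entry1; ring.
  rewrite (_ : r2 = 2 * Z (lshift _ ord0) (rshift _ ord0)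
                    - h * X (rshift _ ord0) (lshift _ ord0)).
    by rewrite rpredB //; [exact: dvdz_mull | exact: dvdz_mulr].
  by rewrite entry2; ring.
(* The square of [e q] divides $r_1^2 + r_2^2 = 2h$; as [e q] divides the odd number $h$, its square
   divides $h$ itself, which is square-free. *)
have eq1 : `|e q|%N = 1%N.
  case: eq_r => /dvdzP[a r1E] /dvdzP[b r2E]; case/dvdzP: eq_h => c hE.
  apply: sqf.
  have : (`|e q| ^ 2 %| 2 * (4 * t + 1))%N.
    have : (e q ^+ 2 %| 2 * h)%Z.
      by apply/dvdzP; exists (a ^+ 2 + b ^+ 2); rewrite -sumE r1E r2E; ring.
    by rewrite dvdzE abszX abszM.
  rewrite Gauss_dvdr // coprimeXl // coprimen2.
  have dvd_eq : (`|e q| %| 4 * t + 1)%N.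
    have : (e q %| h)%Z by rewrite hE dvdz_mull.
    by rewrite dvdzE.
  by apply: dvdn_odd dvd_eq _; rewrite oddD oddM.
have Dq : D q q = 2 * t%:Z * h.
  (* The sign of [e q] is not fixed a priori; [D q q] being nonnegative excludes -1. *)
  have : e q = 1 \/ e q = -1 by move: (e q) eq1; clear; lia.
  case=> eqE; move: (De q) (D_ge0 q); rewrite eqE ?mulr1 //.
  by rewrite mulrN1; move: (D q q) (2 * t%:Z * h) c_gt0; clear; lia.
split; first by rewrite Dq /h; lia.
have ep_h : (e p %| h ^+ 2)%Z.
  have e_dvd_p k : k != q -> (e p %| e k)%Z.
    move=> k_neq_q; apply: e_dvd; rewrite p_val.
    by move: k_neq_q (le_q k); rewrite -val_eqE /= q_val; lia.
  have := smith_dual_minor _ _ _ _ _ p q Z_sum e_dvd_p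
    (lshift _ i0) (lshift _ i1) (lshift _ i2) j1 j2.
  rewrite (Zdiff0 _ _ _ X02) (Zdiff0 _ _ _ X01') mul0r subr0 expr2.
  by case: (Zdiff1 _ _ _ X01) => ->; case: (Zdiff1 _ _ _ X02') => ->;
     rewrite ?mulrNN ?mulrN ?mulNr ?rpredN.
have prodD := EW_det _ _ _ EW_X t_gt0 _ smD.
have q_neq_p : q != p by rewrite -val_eqE /= p_val q_val; lia.
have Dpq_dvd : (D p p * D q q %| (2 * (4 * t + 1) * (4 * t) ^ (2 * t))%N%:Z)%Z.
  by rewrite -prodD (bigD1 p) //= (bigD1 q) //= mulrA dvdz_mulr.
move: (De p) (D_ge0 p) ep_h Dpq_dvd; rewrite Dq /h.
move Dp_def : (D p p) => Dp; case: Dp Dp_def => // dp _ Dep _ ep_h Dpq_dvd.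
congr Posz; apply: (@cofactor_eq_double t dp `|e p|%N t_gt0).
- by have := congr1 absz Dep; rewrite abszM; clear; lia.
- by move: ep_h; rewrite dvdzE abszX.
- by move: Dpq_dvd; rewrite dvdzE abszM; congr (_ * _ %| _)%N; clear; lia.
Qed.

(** * Assembly of the three claims *)

Theorem theorem6p2 (t : nat) (R1 R2 : 'M[int]_((2 * t).+1)) (r1 r2 : int)
    (x : seq int) :
  (0 < t)%N ->
  square_free (4 * t + 1)%N ->
  let J := all_ones (2 * t).+1 in
  let X := block_mx R1 R2 (- R2^T) R1^T in
  is_EW X ->
  R1 *m J = r1 *: J -> R1^T *m J = r1 *: J ->
  R2 *m J = r2 *: J -> R2^T *m J = r2 *: J ->
  invariant_factors X x ->
  [/\ x`_(4 * t + 1) = (2 * t * (4 * t + 1))%N%:Z,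
      x`_(4 * t) = (2 * t)%N%:Z
    & forall l q : nat, odd q -> square_free q -> t = (2 ^ l * q)%N ->
      exists (k : nat) (n : nat -> nat) (n' n'' : nat),
        [/\ (1 <= k <= l + 1)%N,
            n k = (n' + n'')%N,
            drop 1 (take (4 * t) x) =
              flatten [seq nseq (n i) (2 ^ i)%N%:Z | i <- index_iota 1 k]
              ++ nseq n' (2 ^ k)%N%:Z
              ++ nseq n'' (2 ^ k * q)%N%:Z
              ++ flatten [seq nseq (n i) (2 ^ i * q)%N%:Z
                         | i <- index_iota (k + 1) (l + 2)]
          & [/\ (\sum_(1 <= i < k) n i + n' = 2 * t + 1)%N,
                (n'' + \sum_(k + 1 <= i < l + 2) n i = 2 * t - 2)%N
              & (\sum_(1 <= i < l + 2) i * n i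
                 = 3 + 2 * (l + 2) * (t - 1))%N]]].
Proof.
move=> t_gt0 sqf J X EW_X R1J R1TJ R2J R2TJ [D smD xE].
have N_eq : ((2 * t).+1 + (2 * t).+1 = (4 * t).+2)%N by lia.
have size_x : size x = (4 * t).+2 by rewrite xE size_map size_enum_ord.
have xD (i : 'I_((2 * t).+1 + (2 * t).+1)) : x`_i = D i i.
  by rewrite xE (nth_map i) ?size_enum_ord // nth_ord_enum.
have xDe i : (i < (4 * t).+2)%N ->
    exists2 j : 'I_((2 * t).+1 + (2 * t).+1), i = j & x`_i = D j j.
  by rewrite -N_eq => lt_i; exists (Ordinal lt_i) => //; rewrite -xD.
have [|p p_val xp] := xDe (4 * t)%N; first by [].
have [|q q_val xq] := xDe (4 * t + 1)%N; first by rewrite addn1.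
have [Dq Dp] := EW_last_factors t R1 R2 r1 r2 D p q t_gt0 sqf EW_X R1J R1TJ R2J R2TJ smD
  (esym p_val) (esym q_val).
split; [by rewrite xq | by rewrite xp|].
move=> l qq odd_qq sqf_qq tE.
pose d i := absz (x`_i).
have x_ge0 i : (i < (4 * t).+2)%N -> x`_i = (d i)%:Z.
  by case/xDe => j _ xj; rewrite /d xj gez0_abs //; case: smD.
have pm1 i j : X i j = 1 \/ X i j = -1 by case: EW_X.
have [o o_val xo] := xDe 0%N isT.
have [i1 i1_val x1] := xDe 1%N isT.
have [Doo _] := smith_form_pm1 _ X D o o smD pm1 (esym o_val).
have [_ D11] := smith_form_pm1 _ X D o i1 smD pm1 (esym o_val).
have d_dvd i j : (i <= j <= 4 * t)%N -> (d i %| d j)%N.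
  case/andP=> le_ij le_j.
  have [|i' i'E xi] := xDe i; first lia.
  have [|j' j'E xj] := xDe j; first lia.
  have : (D i' i' %| D j' j')%Z; last by rewrite dvdzE /d xi xj.
  apply: (smith_form_dvd _ _ _ _ _ smD).
  by rewrite -i'E -j'E.
(* Removing $x_1 = 1$, $x_{4t+1} = 2t$ and $x_{4t+2} = 2t(4t+1)$ from the determinant
   $2(4t+1)(4t)^{2t}$ leaves $8(4t)^{2t-2}$. *)
have d_prod : (\prod_(1 <= i < 4 * t) d i = 8 * (4 * t) ^ (2 * t - 2))%N.
  have := EW_det t R1 R2 EW_X t_gt0 D smD.
  under eq_bigr => i _ do rewrite -xD x_ge0 -?N_eq //.
  rewrite -(big_morph Posz PoszM (erefl _)) => -[].
  rewrite -(big_mkord xpredT d) N_eq big_nat_recr //= big_nat_recr //=.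
  rewrite big_ltn; last lia.
  have -> : d 0%N = 1%N by rewrite /d xo Doo.
  have -> : d (4 * t)%N = (2 * t)%N by rewrite /d xp Dp.
  have -> : d (4 * t).+1 = (2 * t * (4 * t + 1))%N by rewrite /d -addn1 xq Dq.
  rewrite mul1n; set P := (\prod_(1 <= i < _) _)%N.
  have -> : ((4 * t) ^ (2 * t) = (4 * t) ^ 2 * (4 * t) ^ (2 * t - 2))%N.
    by rewrite -expnD; congr (_ ^ _)%N; lia.
  set Q := (_ ^ (2 * t - 2))%N => PQ.
  have c_gt0 : (0 < 2 * t * (2 * t * (4 * t + 1)))%N by rewrite !muln_gt0 t_gt0 addn1.
  by apply/eqP; rewrite -(eqn_pmul2r c_gt0) mulnA PQ; apply/eqP; ring.
have d1 : (2 %| d 1)%N.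
  by have := D11; rewrite /d x1 dvdzE; apply; rewrite -val_eqE /= -i1_val -o_val.
have dp : d (4 * t)%N = (2 * t)%N by rewrite /d xp Dp.
(* Zero-based positions 1 to $4t-1$ hold $x_2,\ldots,x_{4t}$. *)
have -> : drop 1 (take (4 * t) x) = [seq Posz (d i) | i <- index_iota 1 (4 * t)].
  have size_take_x : size (take (4 * t) x) = (4 * t)%N.
    by rewrite size_takel // size_x; lia.
  apply: (@eq_from_nth _ 0); first by rewrite size_drop size_take_x size_map size_iota.
  move=> i; rewrite size_drop size_take_x => lt_i.
  rewrite nth_drop nth_take; last lia.
  rewrite (nth_map 0%N) ?size_iota // nth_iota // x_ge0 //; lia.
exact: (chain_shape t l qq d t_gt0 sqf_qq odd_qq tE d_dvd d1 dp d_prod).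
Qed.
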